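(* Let $k$ be a positive integer and $\lambda$ a partition of an integer $n$ with $n\ge 2k$. For each of the nine classes $\mathcal D$ of set partitions of $[k]\cup[\overline{k}]$ listed below (the diagrams spanning the indicated subalgebra $A_k$ of the partition algebra $P_k(n)$), apply the insertion procedure $\pi\mapsto(T,S)$ described in the context to the elements $\pi\in\mathcal D$. Then the standard multiset tableaux of shape $\lambda$ and content $[k]$ that occur as $S$ are exactly the standard multiset tableaux of shape $\lambda$ and content $[k]$ with the stated properties; and the standard multiset tableaux of shape $\lambda$ and content $[\overline{k}]$ that occur as $T$ are exactly those of shape $\lambda$ and content $[\overline{k}]$ with the stated properties. 1. All diagrams ($A_k=P_k(n)$): no condition. 2. Planar diagrams ($A_k=PP_k(n)$): the tableau is planar. 3. Permutations ($A_k=\mathbb{C}S_k$): the tableau is matching and all entries of the first row have size $0$. 4. Perfect matchings ($A_k=B_k(n)$): the tableau is matching and all entries of the first row have size $0$ or $2$. 5. Partial permutations ($A_k=R_k(n)$): the tableau is matching and all entries of the first row have size $0$ or $1$. 6. Matchings ($A_k=RB_k(n)$): the tableau is matching and all entries of the first row have size $0$, $1$ or $2$. 7. Planar perfect matchings ($A_k=TL_k(n)$): the tableau is matching and planar and all entries of the first row have size $0$ or $2$. 8. Planar matchings ($A_k=M_k(n)$): the tableau is matching and planar and all entries of the first row have size $0$, $1$ or $2$. 9. Planar partial permutations ($A_k=PR_k(n)$): the tableau is matching and planar and all entries of the first row have size $0$ or $1$.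
   Context: **Basic notation.** $[k]=\{1,\ldots,k\}$ and $[\overline{k}]=\{\overline1,\ldots,\overline{k}\}$ are disjoint, ordered by $1<\cdots<k$ and $\overline1<\cdots<\overline{k}$. Last letter order: for disjoint non-empty subsets $X,Y$ of $[k]$ (or of $[\overline k]$), $X<Y$ if $\max(X)<\max(Y)$; the empty set is smaller than every non-empty set. **Tableaux.** The diagram of a partition $\lambda=(\lambda_1\ge\cdots\ge\lambda_r>0)$ has $\lambda_j$ left-justified cells in row $j$; row $1$ is the first row. A standard multiset tableau of shape $\lambda$ and content $[k]$ is a filling of the cells by subsets of $[k]$ (the empty set may label several cells) such that every letter of $[k]$ lies in exactly one entry, entries weakly increase along each row from left to right, and strictly increase in each column from row $j$ to row $j+1$; similarly for content $[\overline{k}]$. A standard multiset tableau is *matching* if its first row contains only sets of size at most $2$ and all other rows contain only sets of size $1$. Two sets $X,X'$ are *non-crossing* if there are no $a,b\in X$ and $c,d\in X'$ with $a<c<b<d$ or $c<a<d<b$. A letter $c$ is *between* a set $X$ if there are $a,b\in X$ with $a<c<b$. A standard multiset tableau is *planar* if it has at most two rows, the sets in the first row are pairwise non-crossing, and no element belonging to one of the sets in the second row is between any set in the tableau (apart from the set containing that element). **Diagrams.** A set partition $\pi$ of $[k]\cup[\overline{k}]$ is drawn as a graph on vertices $1,\ldots,k$ (top row, left to right) and $\overline1,\ldots,\overline{k}$ (bottom row, left to right), whose connected components are the blocks. It is *planar* if it can be drawn without edge crossings inside the rectangle formed by its vertices (equivalently, it is non-crossing for the cyclic order $1,2,\ldots,k,\overline{k},\ldots,\overline{1}$).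 A block is *propagating* if it meets both $[k]$ and $[\overline{k}]$. $\pi$ is a *matching* if all blocks have size at most $2$; a *perfect matching* if all blocks have size $2$; a *permutation* if it is a perfect matching in which each block contains one element of $[k]$ and one of $[\overline{k}]$; a *partial permutation* if all blocks have size one or two and every block of size two is propagating. **Insertion procedure.** Row insertion of $x$ into a tableau, starting at row $r=1$: if $x$ is greater than or equal to all entries of row $r$ (including the case of an empty row), append $x$ at the end of row $r$; otherwise replace the leftmost entry $\hat x>x$ of row $r$ by $x$ and insert $\hat x$ into row $r+1$ in the same way. The RSK algorithm applied to $\begin{pmatrix} a_1&\cdots&a_p\\ b_1&\cdots&b_p\end{pmatrix}$ successively inserts $b_1,\ldots,b_p$ to build $P$, and records $a_i$ in $Q$ in the cell newly created by the insertion of $b_i$; the output is $(P,Q)$. Given $\pi$, let $\pi_{1},\ldots,\pi_{p}$ be its propagating blocks, put $\pi_j^+=\pi_j\cap[k]$ and $\pi_j^-=\pi_j\cap[\overline{k}]$, and order them so that $\pi_1^+<\cdots<\pi_p^+$ in last letter order. Let $\sigma_1<\cdots<\sigma_a$ be the non-propagating blocks contained in $[k]$, and $\tau_1<\cdots<\tau_b$ those contained in $[\overline{k}]$, in last letter order. Let $(P,Q)$ be the result of RSK (with last letter order) applied to $\begin{pmatrix}\pi_1^+&\cdots&\pi_p^+\\ \pi_1^-&\cdots&\pi_p^-\end{pmatrix}$. Let $T$ be obtained from $P$ by adjoining a new first row (row $i$ of $P$ becoming row $i+1$ of $T$) consisting of $n-p-b$ empty cells followed by cells labelled $\tau_1,\ldots,\tau_b$;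 let $S$ be obtained from $Q$ by adjoining a new first row consisting of $n-p-a$ empty cells followed by cells labelled $\sigma_1,\ldots,\sigma_a$. Empty cells are cells labelled by the empty set. *)

(* Defs.v *)
From mathcomp Require Import all_boot.

Set Implicit Arguments.
Unset Strict Implicit.
Unset Printing Implicit Defensive.

(* The letters of [k] are the elements of 'I_k, the ordinal i standing for the
   letter i + 1.  The disjoint union of [k] and its barred copy is
   'I_k + 'I_k: [inl i] is the unbarred letter and [inr i] the barred one.
   A set of barred letters only, such as an entry of a tableau of barred
   content, is represented by the set of the underlying indices; this respects
   the order since 1bar < ... < kbar. *)

Definition is_partition_of (n : nat) (la : seq nat) : bool :=
  [&& sorted geq la, 0 \notin la & sumn la == n].

(* The maximum of X as a number in 1..k; the value 0 at the empty set makes it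
   smaller than every non-empty set. *)
Definition last_letter (k : nat) (X : {set 'I_k}) : nat := \max_(i in X) i.+1.

Definition ll_lt (k : nat) (X Y : {set 'I_k}) : bool :=
  last_letter X < last_letter Y.

Definition ll_le (k : nat) (X Y : {set 'I_k}) : bool := (X == Y) || ll_lt X Y.

(* A tableau is the sequence of its rows, the first row being the head. *)
Definition tableau (k : nat) := seq (seq {set 'I_k}).

Definition entry (k : nat) (t : tableau k) (i j : nat) : {set 'I_k} :=
  nth set0 (nth [::] t i) j.

Definition first_row (k : nat) (t : tableau k) : seq {set 'I_k} := head [::] t.

Definition standard_multiset_tableau (k : nat) (la : seq nat) (t : tableau k) :
    Prop :=
  [/\ shape t = la,
      forall c : 'I_k, count (fun X : {set 'I_k} => c \in X) (flatten t) = 1,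
      forall r, r \in t -> sorted (@ll_le k) r &
      forall i j, i.+1 < size t -> j < size (nth [::] t i.+1) ->
        ll_lt (entry t i j) (entry t i.+1 j)].

Definition matching_tableau (k : nat) (t : tableau k) : Prop :=
  (forall X, X \in first_row t -> #|X| <= 2) /\
  (forall r X, r \in behead t -> X \in r -> #|X| = 1).

Definition noncrossing (m : nat) (X Y : {set 'I_m}) : bool :=
  ~~ [exists a in X, exists b in X, exists c in Y, exists d in Y,
        [&& a < c, c < b & b < d] || [&& c < a, a < d & d < b]].

Definition between (k : nat) (c : 'I_k) (X : {set 'I_k}) : bool :=
  [exists a in X, exists b in X, (a < c) && (c < b)].

Definition planar_tableau (k : nat) (t : tableau k) : Prop :=
  [/\ size t <= 2,
      pairwise (@noncrossing k) (first_row t) &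
      forall (Y X : {set 'I_k}) (c : 'I_k),
        Y \in nth [::] t 1 -> c \in Y -> X \in flatten t -> X != Y ->
        ~~ between c X].

Definition first_row_sizes (k : nat) (s : seq nat) (t : tableau k) : Prop :=
  forall X, X \in first_row t -> #|X| \in s.

(* A diagram is the set of its blocks. *)
Definition diagram (k : nat) := {set {set 'I_k + 'I_k}}.

Definition is_diagram (k : nat) (pi : diagram k) : bool :=
  partition pi [set: 'I_k + 'I_k].

Definition top_part (k : nat) (B : {set 'I_k + 'I_k}) : {set 'I_k} :=
  [set i | inl i \in B].

Definition bot_part (k : nat) (B : {set 'I_k + 'I_k}) : {set 'I_k} :=
  [set i | inr i \in B].

Definition propagating (k : nat) (B : {set 'I_k + 'I_k}) : bool :=
  (top_part B != set0) && (bot_part B != set0).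

(* Position of a vertex in the cyclic order 1, ..., k, kbar, ..., 1bar *)
Definition boundary_pos (k : nat) (v : 'I_k + 'I_k) : 'I_(k + k) :=
  match v with
  | inl i => lshift k i
  | inr i => rshift k (rev_ord i)
  end.

Definition any_diagram (k : nat) (pi : diagram k) : Prop := True.

(* A set partition can be drawn in the rectangle without crossings iff it is
   non-crossing for the cyclic order of the vertices on the boundary; the latter
   is taken as the definition.  A cyclic order may be cut open anywhere to test
   for crossings. *)
Definition planar_diagram (k : nat) (pi : diagram k) : Prop :=
  forall B C, B \in pi -> C \in pi -> B != C ->
    noncrossing ((@boundary_pos k) @: B) ((@boundary_pos k) @: C).

Definition matching (k : nat) (pi : diagram k) : Prop :=
  forall B, B \in pi -> #|B| <= 2.

Definition perfect_matching (k : nat) (pi : diagram k) : Prop :=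
  forall B, B \in pi -> #|B| = 2.

Definition permutation (k : nat) (pi : diagram k) : Prop :=
  perfect_matching pi /\
  (forall B, B \in pi -> #|top_part B| = 1 /\ #|bot_part B| = 1).

Definition partial_permutation (k : nat) (pi : diagram k) : Prop :=
  forall B, B \in pi ->
    (#|B| = 1 \/ #|B| = 2) /\ (#|B| = 2 -> propagating B).

(* The new tableau, and the index of the row at whose end the new cell lies *)
Fixpoint row_insert (k : nat) (x : {set 'I_k}) (P : tableau k) :
    tableau k * nat :=
  match P with
  | [::] => ([:: [:: x]], 0)
  | r :: P' =>
      if all (fun y => ll_le y x) r then (rcons r x :: P', 0)
      else let j := find (ll_lt x) r in
           let: (P'', i) := row_insert (nth set0 r j) P' in
           (set_nth set0 r j x :: P'', i.+1)
  end.

Definition record_at (k : nat) (i : nat) (a : {set 'I_k}) (Q : tableau k) :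
    tableau k :=
  set_nth [::] Q i (rcons (nth [::] Q i) a).

Definition rsk_step (k : nat) (PQ : tableau k * tableau k)
    (ab : {set 'I_k} * {set 'I_k}) : tableau k * tableau k :=
  let: (P, i) := row_insert ab.2 PQ.1 in (P, record_at i ab.1 PQ.2).

Definition rsk (k : nat) (w : seq ({set 'I_k} * {set 'I_k})) :
    tableau k * tableau k :=
  foldl (@rsk_step k) ([::], [::]) w.

Definition propagating_biword (k : nat) (pi : diagram k) :
    seq ({set 'I_k} * {set 'I_k}) :=
  sort (fun u v => ll_le u.1 v.1)
    [seq (top_part B, bot_part B) | B <- enum pi & propagating B].

Definition top_blocks (k : nat) (pi : diagram k) : seq {set 'I_k} :=
  sort (@ll_le k) [seq top_part B | B <- enum pi & bot_part B == set0].

Definition bot_blocks (k : nat) (pi : diagram k) : seq {set 'I_k} :=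
  sort (@ll_le k) [seq bot_part B | B <- enum pi & top_part B == set0].

Definition add_first_row (k : nat) (m : nat) (s : seq {set 'I_k})
    (t : tableau k) : tableau k :=
  (nseq (m - size s) set0 ++ s) :: t.

(* The pair (T, S).  The subtractions do not truncate when 2 * k <= n. *)
Definition insertion (k n : nat) (pi : diagram k) : tableau k * tableau k :=
  let w := propagating_biword pi in
  let: (P, Q) := rsk w in
  (add_first_row (n - size w) (bot_blocks pi) P,
   add_first_row (n - size w) (top_blocks pi) Q).

Definition insertion_tableaux_are (k n : nat) (la : seq nat)
    (D : diagram k -> Prop) (C : tableau k -> Prop) : Prop :=
  (forall S : tableau k, standard_multiset_tableau la S ->
     ((exists pi : diagram k,
         [/\ is_diagram pi, D pi & (insertion n pi).2 = S]) <-> C S)) /\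
  (forall T : tableau k, standard_multiset_tableau la T ->
     ((exists pi : diagram k,
         [/\ is_diagram pi, D pi & (insertion n pi).1 = T]) <-> C T)).

(* Main.v *)
Require Import Defs.
From mathcomp Require Import all_boot zify.

Set Implicit Arguments.
Unset Strict Implicit.
Unset Printing Implicit Defensive.

(** A block of a diagram contributes to each of the two insertion tableaux the
    set of its letters in the corresponding row of the diagram: to the first row
    of the tableau if the block does not propagate, to the rows below if it does.
    The sizes of the blocks thus become sizes of entries, and conversely.

    The planar classes require a look at the insertion itself.  The propagating
    blocks of a planar diagram succeed one another from left to right, in both
    rows ([planar_biword_sorted]); hence the inserted word is increasing, nothing
    is ever bumped, and the tableaux have at most two rows.  What is left of the
    absence of crossings, seen from one row of the diagram, is that
    non-propagating blocks do not cross there and that no propagating block has a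
    letter between two letters of another block, since it would have to cross
    that block on its way to the other row.

    Conversely, each standard multiset tableau [S] occurs in a pair with itself:
    some diagram is sent to [(S, S)], which settles the claims about [S] and
    about [T] together ([standard_realized]).  The non-propagating blocks of that
    diagram are the non-empty sets of the first row of [S], placed in both rows.
    Its propagating blocks come from a biword sent to [(Q, Q)] by RSK, [Q] being
    formed by the lower rows of [S]; such a biword exists because every pair of
    semistandard tableaux of one shape arises from RSK, by undoing the insertions
    one after the other ([rsk_onto]).  Every block is then made of one entry of
    [S], or of two entries of [Q], so the conditions on sizes carry over.  If [S]
    has at most two rows, [Q] is a single row, and the biword that pairs each
    entry of it with itself serves; the diagram is then symmetric under the
    exchange of its rows, and it is planar as soon as [S] is
    ([mirror_planar]). *)

(** * The last letter order *)

Section LastLetter.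
Variable k : nat.
Implicit Types (X Y : {set 'I_k}) (i : 'I_k).

Lemma last_letter_mem X : X != set0 -> exists2 i, i \in X & last_letter X = i.+1.
Proof.
rewrite -card_gt0 => X_gt0.
by have [i iX eqi] := eq_bigmax_cond (fun i : 'I_k => i.+1) X_gt0; exists i.
Qed.

Lemma ltn_last_letter i X : i \in X -> i < last_letter X.
Proof. by move=> iX; rewrite /last_letter (bigD1 i) //= leq_maxl. Qed.

Lemma last_letter_gt0 X : (0 < last_letter X) = (X != set0).
Proof.
apply/idP/idP => [|/set0Pn[i /ltn_last_letter]]; last exact: leq_trans.
by apply: contraTneq => ->; rewrite /last_letter big_set0.
Qed.

(** Distinct members of a disjoint family have distinct last letters; this is
    the only way in which disjointness enters the analysis of insertion. *)
Lemma eq_last_letter X Y : X != set0 -> last_letter X = last_letter Y ->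
  exists2 i, i \in X & i \in Y.
Proof.
move=> X0 eqXY; have [i iX Xi] := last_letter_mem X0; exists i => //.
have [|j jY Yj] := @last_letter_mem Y; first by rewrite -last_letter_gt0 -eqXY Xi.
by have -> : i = j by apply/val_inj; apply: succn_inj; rewrite -Xi -Yj.
Qed.

Lemma ll_leW X Y : ll_le X Y -> last_letter X <= last_letter Y.
Proof. by case/orP=> [/eqP->|/ltnW]. Qed.

Lemma ll_le_trans : transitive (@ll_le k).
Proof.
move=> Y X Z /orP[/eqP-> //|ltXY] leYZ.
by apply/orP; right; apply: leq_trans ltXY (ll_leW leYZ).
Qed.

Lemma ll_le_anti : antisymmetric (@ll_le k).
Proof.
move=> X Y /andP[/orP[/eqP //|ltXY] /ll_leW].
by rewrite leqNgt (ltXY : _ < _).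
Qed.

Lemma ll_leE (L : {pred {set 'I_k}}) : {in L &, injective (@last_letter k)} ->
  {in L &, forall X Y, ll_le X Y = (last_letter X <= last_letter Y)}.
Proof.
move=> inj X Y LX LY; apply/idP/idP; first exact: ll_leW.
by rewrite leq_eqVlt => /orP[/eqP/inj->|lt]; rewrite // /ll_le ?eqxx //; apply/orP; right.
Qed.

Lemma ll_le_total (L : {pred {set 'I_k}}) :
  {in L &, injective (@last_letter k)} -> {in L &, total (@ll_le k)}.
Proof. by move=> inj X Y LX LY; rewrite !(ll_leE inj) // leq_total. Qed.

End LastLetter.

(** A list is recovered by sorting any of its rearrangements, under an order
    that is only required to be linear on its entries. *)
Lemma sort_perm_sorted (T : eqType) (leT : rel T) (s w : seq T) :
    transitive leT -> {in w &, total leT} -> {in w &, antisymmetric leT} ->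
  sorted leT w -> perm_eq s w -> sort leT s = w.
Proof.
move=> trT totT antiT sw; rewrite perm_sym => psw.
rewrite -(sorted_sort trT sw); apply/esym/perm_sort_inP => //.
by move=> x y z _ _ _; apply: trT.
Qed.

(** * Families of sets in which every point lies exactly once *)

Section ExactCover.
Variables (T : finType) (s : seq {set T}).
Implicit Types (x : T) (A B : {set T}).
Hypothesis cover1 : forall x, count (fun A => x \in A) s = 1.

Lemma exact_cover_inj A B x : A \in s -> B \in s -> x \in A -> x \in B -> A = B.
Proof.
move=> As Bs xA xB; have := cover1 x; rewrite -size_filter.
have: A \in [seq C : {set T} <- s | x \in C] by rewrite mem_filter xA.
have: B \in [seq C : {set T} <- s | x \in C] by rewrite mem_filter xB.
by case: filter => [|C [|]] //; rewrite !inE => /eqP-> /eqP->.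
Qed.

Hypothesis nonempty : set0 \notin s.

Lemma exact_cover_uniq : uniq s.
Proof.
apply: count_mem_uniq => A; case: (boolP (A \in s)) => [As|]; last by move/count_memPn.
have /set0Pn[x xA] : A != set0 by apply: contraNneq nonempty => <-.
(* A set containing [x] occurs at most as often as [x] is covered. *)
apply/anti_leq/andP; split; last by rewrite -has_count has_pred1.
by apply: leq_trans (eq_leq (cover1 x)); apply: sub_count => B /eqP->.
Qed.

Lemma exact_cover_partition : partition [set A in s] [set: T].
Proof.
apply/and3P; split; last by rewrite inE.
- apply/eqP/setP=> x; rewrite !inE.
  have: has (fun A => x \in A) s by rewrite has_count cover1.
  by case/hasP=> A As xA; apply/bigcupP; exists A; rewrite ?inE.
- apply/trivIsetP=> A B; rewrite !inE => As Bs; apply: contraR.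
  case/pred0Pn=> x /andP[xA xB].
  exact/eqP/(exact_cover_inj As Bs xA xB).
Qed.

End ExactCover.

(** * Reverse row insertion *)

Section ReverseInsertion.
Variable k : nat.
Local Notation key := (@last_letter k).
Local Notation rnth := (nth (set0 : {set 'I_k})).
Implicit Types (x y : {set 'I_k}) (r s : seq {set 'I_k}) (P Q : tableau k).

(** Entries are compared through their last letters, which are totally ordered
    whatever the sets may be. *)
Definition row_ok r := ~~ nilp r && sorted (relpre key leq) r.

Definition below r s :=
  (size s <= size r) && all (fun j => key (rnth r j) < key (rnth s j)) (iota 0 (size s)).

Lemma belowP r s : reflect
  (size s <= size r /\ forall j, j < size s -> key (rnth r j) < key (rnth s j))
  (below r s).
Proof.
apply: (iffP andP) => [[le_s /allP lt_s]|[le_s lt_s]]; split=> //.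
  by move=> j lt_j; apply: lt_s; rewrite mem_iota.
by apply/allP=> j; rewrite mem_iota; apply: lt_s.
Qed.

Definition semistandard P := all row_ok P && sorted below P.

Lemma semistandard_cons r P :
  semistandard (r :: P) = [&& row_ok r, semistandard P & below r (head [::] P)].
Proof.
rewrite /semistandard; case: P => [|s P] /=; first by rewrite /below /= !andbT.
by rewrite -!andbA; do !bool_congr.
Qed.

Lemma sorted_key_leq r i j : sorted (relpre key leq) r -> i <= j -> j < size r ->
  key (rnth r i) <= key (rnth r j).
Proof.
move=> sr ij jr.
apply: (sorted_leq_nth (leT := relpre key leq) _ _ set0 sr) => //=.
  by move=> ? ? ?; apply: leq_trans.
- by move=> ?; apply: leqnn.
- exact: leq_ltn_trans ij jr.
Qed.

Lemma find_eq (T : Type) (x0 : T) (a : pred T) (s : seq T) m :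
  m < size s -> a (nth x0 s m) -> (forall i, i < m -> ~~ a (nth x0 s i)) -> find a s = m.
Proof.
move=> ms am lt_m; case: (ltngtP (find a s) m) => // [lt|gt].
  have ha: has a s by rewrite has_find; apply: ltn_trans ms.
  by have := lt_m _ lt; rewrite (nth_find x0 ha).
by rewrite (before_find x0 gt) in am.
Qed.

(** Every insertion that ended at the corner of row [i] can be reversed.  The letter
    [y] expelled from the lower rows goes back into the head row, in the place
    of the rightmost letter smaller than [y]; such a letter exists because the
    one above the former place [j] of [y] is smaller.  The last conjunct carries
    what is needed to see that columns still increase one level up: entries of
    the head row only grow, and those from the place of [x] on exceed [x]. *)
Lemma row_insert_onto P i :
    {in flatten P &, injective key} -> semistandard P ->
    size (nth [::] P i.+1) < size (nth [::] P i) ->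
  exists x P', [/\ row_insert x P' = (P, i), semistandard P',
    perm_eq (flatten P) (x :: flatten P'), shape P = incr_nth (shape P') i &
    exists j, let r := head [::] P in let r' := head [::] P' in
      [/\ j < size r, rnth r j = x, size r' <= size r,
          forall t, t < size r' -> key (rnth r t) <= key (rnth r' t) &
          forall t, j <= t < size r' -> key x < key (rnth r' t)]].
Proof.
elim: P i => [|r P IH] [|i] inj; rewrite ?nth_nil //.
  rewrite semistandard_cons => /and3P[/andP[r0 sr] ssP rP] /= corner.
  case/lastP: r => [|r x] // in r0 sr rP corner inj *; exists x.
  (* A row emptied by the removal of its only cell disappears; being a corner, it
     was the last one. *)
  exists (if nilp r then [::] else r :: P).
  have [r_nil|r_ne] := boolP (nilp r).
    move: corner; rewrite (nilP r_nil) /=.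
    case: P ssP {IH inj rP} => [|[|? ?] ?] //= _ _.
    by split=> //; exists 0.
  have lex: all (fun y => ll_le y x) r.
    apply/allP=> y yr; rewrite (ll_leE inj) /=; first last.
    - by rewrite mem_cat mem_rcons mem_head.
    - by rewrite mem_cat mem_rcons inE yr orbT.
    have yi: index y r < size r by rewrite index_mem.
    have := sorted_key_leq sr (ltnW yi).
    rewrite size_rcons !nth_rcons yi ltnn eqxx nth_index //.
    exact.
  split=> /=.
  - by rewrite lex.
  - rewrite semistandard_cons /row_ok r_ne ssP /=; apply/andP; split.
      by have /= := sr; rewrite -cats1 => /cat_sorted2[].
    case/belowP: rP; rewrite nth0 size_rcons in corner * => _ lt.
    apply/belowP; split=> // j js.
    by have := lt j js; rewrite nth_rcons (leq_trans js).
  - by rewrite cat_rcons perm_sym -cat1s perm_catCA.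
  - by rewrite size_rcons.
  - exists (size r); rewrite size_rcons nth_rcons ltnn eqxx; split=> // t.
      by move=> lt; rewrite nth_rcons lt.
    by case/andP=> le lt; rewrite ltnNge le in lt.
rewrite semistandard_cons => /and3P[/andP[r0 sr] ssP /belowP[szP ltP]] /= corner.
have [|y [P' [ins ssP' perm_P shP [j [jP yE szP' leP' gtP']]]]] := IH i _ ssP corner.
  by move=> u v uP vP; apply: inj; rewrite /= mem_cat (uP, vP) orbT.
(* [f] is the first position of the head row that [y] may not take, so the entry
   just before it is the one that [y] replaces. *)
pose f := find (fun z => key y <= key z) r.
have before t : t < f -> key (rnth r t) < key y.
  by move=> /(before_find set0)/= /negbT; rewrite -ltnNge.
have after t : f <= t -> t < size r -> key y <= key (rnth r t).
  move=> ft tr; apply: leq_trans (sorted_key_leq sr ft tr).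
  apply: (@nth_find _ set0 (fun z => key y <= key z)).
  by rewrite has_find; apply: leq_ltn_trans tr.
have jf : j < f.
  rewrite ltnNge; apply/negP=> /after le; have := ltP j jP.
  by rewrite yE ltnNge le // (leq_trans jP).
have f_le : f <= size r by apply: find_size.
pose m := f.-1; have fm : f = m.+1 by rewrite /m; lia.
have jm : j <= m by lia.
have mr : m < size r by lia.
have xy : key (rnth r m) < key y by apply: before; lia.
pose r' := set_nth set0 r m y.
have sz_r' : size r' = size r by rewrite size_set_nth; lia.
have nth_r' t : rnth r' t = if t == m then y else rnth r t by rewrite nth_set_nth.
exists (rnth r m), (r' :: P'); split.
- rewrite /=; case: ifP => [/allP/(_ y)|_].
    have y_in : y \in r'.
      by rewrite -[y](_ : rnth r' m = y) ?mem_nth ?sz_r' // nth_r' eqxx.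
    by move/(_ y_in)/ll_leW; rewrite leqNgt xy.
  have -> : find (ll_lt (rnth r m)) r' = m.
    apply: (find_eq (x0 := set0)); rewrite ?sz_r' // ?nth_r' ?eqxx // => t tm.
    rewrite nth_r' ltn_eqF // /ll_lt -leqNgt; exact: sorted_key_leq (ltnW tm) mr.
  rewrite nth_r' eqxx ins /r' set_set_nth eqxx; congr (_ :: _, _).
  apply: (@eq_from_nth _ set0); rewrite size_set_nth; first by lia.
  by move=> t _; rewrite nth_set_nth /=; case: eqP => // ->.
- rewrite semistandard_cons ssP' /row_ok; apply/and3P; split=> //.
    apply/andP; split; first by rewrite /nilp sz_r' -lt0n; lia.
    apply/(sortedP set0) => t; rewrite sz_r' /= => tr; rewrite !nth_r'.
    case: eqP => [tm|/eqP tm]; first by rewrite gtn_eqF ?tm //; apply: after; lia.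
    case: eqP => [tm1|_]; last exact: sorted_key_leq.
    by apply: ltnW; apply: before; lia.
  apply/belowP; split; first by rewrite sz_r'; lia.
  move=> t tP; rewrite nth_r'; case: eqP => [tm|_]; first by apply: gtP'; lia.
  have tP1 : t < size (head [::] P) by lia.
  exact: leq_trans (ltP t tP1) (leP' t tP).
- apply/permP=> a; have /permP/(_ a) := perm_P.
  rewrite /= !count_cat /= => ->; rewrite count_set_nth_ltn //.
  have : a (rnth r m) <= count a r.
    case am: (a _) => //; rewrite -has_count; apply/hasP; exists (rnth r m) => //.
    exact: mem_nth.
  by case: (a (rnth r m)); case: (a y) => /=; lia.
- by rewrite /= sz_r' shP.
- exists m; split=> //=; rewrite ?sz_r' // => t tr.
    by rewrite nth_r'; case: eqP => [->|//]; apply: ltnW.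
  rewrite nth_r'; case: eqP => // tm; apply: leq_trans xy _; apply: after; lia.
Qed.

(** A largest entry of a recording tableau sits in a corner, the cell that was
    created last.  Going down the rows, one keeps the last entry of the current
    row unless the rows below contain a larger one. *)
Lemma record_at_onto Q : semistandard Q -> ~~ nilp Q ->
  exists i a Q', [/\ Q = record_at i a Q' /\ semistandard Q',
    perm_eq (flatten Q) (a :: flatten Q'), shape Q = incr_nth (shape Q') i,
    size (nth [::] Q i.+1) < size (nth [::] Q i) &
    {in flatten Q, forall b, key b <= key a}].
Proof.
elim: Q => [|r Q IH] // ss _.
move: ss; rewrite semistandard_cons => /and3P[/andP[r0 sr] ssQ /belowP[szQ ltQ]].
have r_last b : b \in r -> key b <= key (last set0 r).
  case/(nthP set0)=> t tr <-; have r_gt0 := leq_ltn_trans (leq0n t) tr.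
  by rewrite -nth_last; apply: sorted_key_leq => //; rewrite -ltnS prednK.
have [/allP Q_le|/allPn[b bQ b_gt]] :=
  boolP (all (fun b => key b <= key (last set0 r)) (flatten Q)); last first.
  have [|i [a [Q' [[eqQ ssQ'] permQ shQ corner a_max]]]] := IH ssQ.
    by apply: contraTN bQ => /nilP->.
  have r_lt : key (last set0 r) < key a.
    by apply: leq_trans (a_max b bQ); rewrite ltnNge.
  exists i.+1, a, (r :: Q'); split=> //.
  - split; first by rewrite {1}eqQ.
    rewrite semistandard_cons /row_ok r0 sr ssQ' /=; apply/belowP.
    have [le_head eq_head] : size (head [::] Q') <= size (head [::] Q) /\
      forall t, t < size (head [::] Q') -> rnth (head [::] Q) t = rnth (head [::] Q') t.
      rewrite eqQ; case: (Q') i {eqQ corner shQ} => [|s Q1] [|i] //=.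
      by rewrite size_rcons; split=> // t ts; rewrite nth_rcons ts.
    split=> [|t ts]; first exact: leq_trans le_head szQ.
    by rewrite -eq_head // ltQ // (leq_trans ts).
  - by rewrite /= perm_sym -cat1s perm_catCA perm_cat2l /= perm_sym.
  - by rewrite /= shQ.
  - move=> c; rewrite /= mem_cat => /orP[cr|cQ]; last exact: a_max.
    exact: leq_trans (r_last c cr) (ltnW r_lt).
case/lastP: r => [|r a] // in r0 sr szQ ltQ Q_le r_last *.
rewrite last_rcons in Q_le r_last.
have corner : size (head [::] Q) < size (rcons r a).
  rewrite ltn_neqAle szQ andbT; apply/negP=> /eqP sz_eq.
  have szr : size r < size (head [::] Q) by rewrite sz_eq size_rcons.
  have := ltQ _ szr; rewrite nth_rcons ltnn eqxx ltnNge Q_le //.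
  by case: (Q) szr => //= s Q1 szr; rewrite mem_cat mem_nth.
exists 0, a, (if nilp r then [::] else r :: Q).
have [r_nil|r_ne] := boolP (nilp r).
  move: corner ssQ; rewrite (nilP r_nil); case: (Q) => [|[|? ?] ?] // _ _.
  by split=> // b; rewrite !inE => /eqP->.
split=> //=.
- split=> //; rewrite semistandard_cons /row_ok r_ne ssQ /=; apply/andP; split.
    by have /= := sr; rewrite -cats1 => /cat_sorted2[].
  rewrite size_rcons in corner; apply/belowP; split=> // j js.
  by have := ltQ j js; rewrite nth_rcons (leq_trans js).
- by rewrite cat_rcons perm_sym -cat1s perm_catCA.
- by rewrite size_rcons.
- by move=> c; rewrite mem_cat => /orP[/r_last|/Q_le].
Qed.

Lemma rsk_rcons (w : seq ({set 'I_k} * {set 'I_k})) u :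
  rsk (rcons w u) = rsk_step (rsk w) u.
Proof. by rewrite /rsk foldl_rcons. Qed.

(** The shape before the creation of a cell is determined by the shape after it,
    but only in the absence of empty rows: [[::]] and [[:: 0]] both grow to
    [[:: 1]]. *)
Lemma incr_nth_injl (u v : seq nat) i :
  0 \notin u -> 0 \notin v -> incr_nth u i = incr_nth v i -> u = v.
Proof.
elim: u v i => [|m u IH] [|l v] [|i] //=; rewrite ?inE !negb_or.
- by move=> _ + [l0]; rewrite -l0.
- by move=> _ + [l0]; rewrite -l0.
- by move=> + _ [m0]; rewrite m0.
- by move=> + _ [m0]; rewrite m0.
- by move=> _ _ [-> ->].
- by move=> /andP[_ u0] /andP[_ v0] [-> /IH->].
Qed.

Lemma shape_neq0 P : semistandard P -> 0 \notin shape P.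
Proof.
case/andP=> /allP rows _; apply/mapP=> -[r /rows/andP[r0 _] /esym/eqP].
exact/negP.
Qed.

(** Undo the insertions one by one: the largest entry of [Q] says in which row
    the last insertion ended. *)
Lemma rsk_onto P Q :
    {in flatten P &, injective key} -> semistandard P -> semistandard Q ->
    shape P = shape Q ->
  exists w, [/\ rsk w = (P, Q), perm_eq (unzip1 w) (flatten Q),
    perm_eq (unzip2 w) (flatten P) & pairwise (relpre key leq) (unzip1 w)].
Proof.
move: {2}(size (flatten Q)) (erefl (size (flatten Q))) => n.
elim: n P Q => [|n IH] P Q szQ inj ssP ssQ shPQ.
  have Q_nil : Q = [::].
    case: Q szQ ssQ {shPQ} => // r Q; rewrite /= size_cat => /eqP.
    rewrite addn_eq0 => /andP[r0 _].
    by rewrite semistandard_cons /row_ok /nilp r0.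
  by exists [::]; rewrite Q_nil in shPQ *; case: P shPQ {inj ssP}.
have [|i [a [Q' [[eqQ ssQ'] permQ shQ corner a_max]]]] := record_at_onto ssQ.
  by apply: contra_eqN szQ => /nilP->.
have size_row (R : tableau k) t : size (nth [::] R t) = nth 0 (shape R) t.
  case: (ltnP t (size R)) => ltR; first by rewrite (nth_map [::]).
  by rewrite !nth_default ?size_map.
have [|x [P' [ins ssP' perm_P shP _]]] := row_insert_onto inj ssP (i := i).
  by rewrite !size_row shPQ -!size_row.
have [|||||w [rsk_w w1 w2 sw]] := IH P' Q'.
- by have := perm_size permQ; rewrite szQ => -[].
- by move=> b c bP cP; apply: inj; rewrite (perm_mem perm_P) inE (bP, cP) orbT.
- exact: ssP'.
- exact: ssQ'.
- by apply: (incr_nth_injl (i := i)); rewrite ?shape_neq0 // -shP -shQ.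
exists (rcons w (a, x)); split.
- by rewrite rsk_rcons rsk_w /rsk_step /= ins -eqQ.
- by rewrite /unzip1 map_rcons perm_rcons perm_sym (perm_trans permQ) //
    perm_cons perm_sym.
- by rewrite /unzip2 map_rcons perm_rcons perm_sym (perm_trans perm_P) //
    perm_cons perm_sym.
rewrite /unzip1 map_rcons -cats1 pairwise_cat sw andbT allrel1r /=; apply/allP=> b bw.
by apply: a_max; rewrite (perm_mem permQ) inE -(perm_mem w1) bw orbT.
Qed.

(** Inserting an increasing word never bumps. *)
Definition one_row (r : seq {set 'I_k}) : tableau k := if nilp r then [::] else [:: r].

Lemma rsk_increasing (w : seq ({set 'I_k} * {set 'I_k})) :
  pairwise (@ll_le k) (unzip2 w) -> rsk w = (one_row (unzip2 w), one_row (unzip1 w)).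
Proof.
elim/last_ind: w => [|w [a b] IH] //.
rewrite /unzip2 map_rcons -cats1 pairwise_cat => /and3P[+ /IH {}IH _].
rewrite allrel1r cats1 rsk_rcons IH /rsk_step /unzip1 map_rcons => le_b.
by case: w le_b {IH} => [|u w] //= ->.
Qed.

End ReverseInsertion.
(** * Diagrams with prescribed insertion tableaux *)

Section Blocks.
Variable k : nat.
Implicit Types (X Y : {set 'I_k}) (B : {set 'I_k + 'I_k}).

Definition block (u : {set 'I_k} * {set 'I_k}) : {set 'I_k + 'I_k} :=
  [set v | match v with inl i => i \in u.1 | inr i => i \in u.2 end].

Lemma top_block u : top_part (block u) = u.1.
Proof. by apply/setP=> i; rewrite !inE. Qed.

Lemma bot_block u : bot_part (block u) = u.2.
Proof. by apply/setP=> i; rewrite !inE. Qed.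

Lemma block_inj : injective block.
Proof.
by move=> [X Y] [X' Y'] eqB; congr (_, _); [have /= := congr1 (@top_part k) eqB
  | have /= := congr1 (@bot_part k) eqB]; rewrite ?top_block ?bot_block.
Qed.

Lemma block_parts B : block (top_part B, bot_part B) = B.
Proof. by apply/setP=> -[i|i]; rewrite !inE. Qed.

Lemma block_eq0 u : (block u == set0) = (u.1 == set0) && (u.2 == set0).
Proof.
have -> : set0 = block (set0, set0) by apply/setP=> -[i|i]; rewrite !inE.
by rewrite (inj_eq block_inj) /eq_op.
Qed.

Lemma card_parts B : #|B| = #|top_part B| + #|bot_part B|.
Proof.
rewrite -(card_imset _ (@inl_inj 'I_k 'I_k)) -(card_imset _ (@inr_inj 'I_k 'I_k)).
rewrite -cardsUI [X in _ = _ + X](_ : _ = 0) ?addn0; first last.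
  apply/eqP; rewrite cards_eq0 -subset0; apply/subsetP=> v.
  by case/setIP=> /imsetP[i _ ->] /imsetP[].
congr #|pred_of_set _|; apply/setP=> v; rewrite !inE; case: v => i.
  rewrite mem_imset ?inE; last exact: inl_inj.
  by rewrite [X in _ || X](_ : _ = false) ?orbF //; apply/imsetP=> -[].
rewrite orbC mem_imset ?inE; last exact: inr_inj.
by rewrite [X in _ || X](_ : _ = false) ?orbF //; apply/imsetP=> -[].
Qed.

End Blocks.

Section Mirror.
Variables (k n : nat) (S : tableau k).
Variable w : seq ({set 'I_k} * {set 'I_k}).
Local Notation key := (@last_letter k).
Let Q : tableau k := behead S.
Let sigma := [seq X <- first_row S | X != set0].

(** The sets of the first row of [S] become blocks in both rows of the diagram,
    and the biword [w] supplies the propagating blocks. *)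
Definition mirror_parts : seq ({set 'I_k} * {set 'I_k}) :=
  [seq (X, set0) | X <- sigma] ++ [seq (set0, X) | X <- sigma] ++ w.

Definition mirror_diagram : diagram k := [set B in map (@block k) mirror_parts].

Hypothesis S_cover : forall c, count (fun X : {set 'I_k} => c \in X) (flatten S) = 1.
Hypothesis S_size : size (flatten S) = n.
Hypothesis n_gt0 : 0 < n.
Hypothesis first_sorted : sorted (@ll_le k) (first_row S).
Hypothesis Q_neq0 : set0 \notin flatten Q.
Hypothesis w_top : perm_eq (unzip1 w) (flatten Q).
Hypothesis w_bot : perm_eq (unzip2 w) (flatten Q).
Hypothesis w_sorted : pairwise (relpre key leq) (unzip1 w).
Hypothesis w_rsk : rsk w = (Q, Q).

Let S_split : S = first_row S :: Q.
Proof. by rewrite /Q; case: (S) S_size n_gt0 => //= <-. Qed.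

Let letters_cover c : count (fun X : {set 'I_k} => c \in X) (sigma ++ flatten Q) = 1.
Proof.
rewrite -(S_cover c) [in RHS]S_split /= !count_cat count_filter; congr (_ + _).
apply: eq_count => X /=; case: (boolP (c \in X)) => //= cX.
by apply/set0Pn; exists c.
Qed.

Let letters_neq0 : set0 \notin sigma ++ flatten Q.
Proof. by rewrite mem_cat mem_filter eqxx (negPf Q_neq0). Qed.

Let key_inj : {in sigma ++ flatten Q &, injective key}.
Proof.
move=> X Y XL YL eqXY; have [|c cX cY] := eq_last_letter _ eqXY.
  by apply: contraNneq letters_neq0 => <-.
exact: (exact_cover_inj letters_cover XL YL cX cY).
Qed.

Let parts_cover v :
  count (fun B : {set 'I_k + 'I_k} => v \in B) (map (@block k) mirror_parts) = 1.
Proof.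
rewrite count_map !count_cat !count_map; case: v => c.
  rewrite -(letters_cover c) count_cat; congr (_ + _).
    by apply: eq_count => X; rewrite /= inE.
  rewrite -[RHS]add0n; congr (_ + _).
    by rewrite -(count_pred0 sigma); apply: eq_count => X; rewrite /= !inE.
  rewrite -(permP w_top) /unzip1 count_map; by apply: eq_count => X; rewrite /= inE.
rewrite -(letters_cover c) count_cat -[RHS]add0n; congr (_ + _).
  by rewrite -(count_pred0 sigma); apply: eq_count => X; rewrite /= !inE.
congr (_ + _); first by apply: eq_count => X; rewrite /= inE.
rewrite -(permP w_bot) /unzip2 count_map; by apply: eq_count => X; rewrite /= inE.
Qed.

Let w_neq0 u : u \in w -> (u.1 != set0) && (u.2 != set0).
Proof.
move=> uw; apply/andP; split; apply: contraNneq Q_neq0 => <-.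
  by rewrite -(perm_mem w_top); apply: map_f.
by rewrite -(perm_mem w_bot); apply: map_f.
Qed.

Let parts_neq0 : set0 \notin map (@block k) mirror_parts.
Proof.
apply/mapP=> -[u u_in /esym/eqP]; rewrite block_eq0.
move: u_in; rewrite !mem_cat => /or3P[/mapP[X]|/mapP[X]|/w_neq0/andP[/negPf-> _] //].
  by rewrite mem_filter => /andP[/negPf X0 _] -> /=; rewrite X0.
by rewrite mem_filter => /andP[/negPf X0 _] -> /=; rewrite X0 andbF.
Qed.

Lemma mirror_is_diagram : is_diagram mirror_diagram.
Proof. exact: exact_cover_partition. Qed.

Let perm_mirror (p : pred {set 'I_k + 'I_k}) (T : eqType) (f : {set 'I_k + 'I_k} -> T) :
  perm_eq [seq f B | B <- enum mirror_diagram & p B]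
    [seq f (block u) | u <- mirror_parts & p (block u)].
Proof.
rewrite (map_comp f (@block k)) -filter_map; apply/perm_map/perm_filter.
apply: uniq_perm; rewrite ?enum_uniq //; first exact: exact_cover_uniq.
by move=> B; rewrite mem_enum inE.
Qed.

(* Each of the three groups of blocks is either kept or dropped as a whole by the
   selections that enter the insertion procedure. *)
Let mirror_filter (p : pred {set 'I_k + 'I_k}) (b1 b2 b3 : bool) :
    {in sigma, forall X, p (block (X, set0)) = b1} ->
    {in sigma, forall X, p (block (set0, X)) = b2} ->
    {in w, forall u, p (block u) = b3} ->
  [seq u <- mirror_parts | p (block u)] =
    (if b1 then [seq (X, set0) | X <- sigma] else [::]) ++
    (if b2 then [seq (set0, X) | X <- sigma] else [::]) ++ (if b3 then w else [::]).
Proof.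
move=> p1 p2 p3; rewrite !filter_cat !filter_map.
rewrite (eq_in_filter (a2 := fun=> b1) p1) (eq_in_filter (a2 := fun=> b2) p2).
rewrite (eq_in_filter (a2 := fun=> b3) p3).
by case: b1 b2 b3 {p1 p2 p3} => [] [] []; rewrite ?filter_predT ?filter_pred0.
Qed.

Let mirror_biword : propagating_biword mirror_diagram = w.
Proof.
have w1 u : u \in w -> u.1 \in sigma ++ flatten Q.
  by move=> uw; rewrite mem_cat -(perm_mem w_top) map_f ?orbT.
have w1_uniq : uniq (unzip1 w).
  rewrite (perm_uniq w_top); have := exact_cover_uniq letters_cover letters_neq0.
  by rewrite cat_uniq => /and3P[].
apply: sort_perm_sorted.
- by move=> u v t; apply: ll_le_trans.
- by move=> u v uw vw; apply: (ll_le_total key_inj); apply: w1.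
- move=> u v uw vw /ll_le_anti.
  case/(nthP (set0, set0)): uw => i iw <-; case/(nthP (set0, set0)): vw => j jw <-.
  rewrite -!(nth_map _ set0 fst) // => /eqP; rewrite nth_uniq ?size_map //.
  by move/eqP->.
- apply: pairwise_sorted; move: w_sorted; rewrite /unzip1 pairwise_map.
  apply: (@sub_in_pairwise _ (mem w)); last exact/allP.
  by move=> u v uw vw; rewrite /= (ll_leE key_inj) ?w1.
apply: perm_trans (perm_mirror _ _) _.
rewrite (mirror_filter (b1 := false) (b2 := false) (b3 := true)) //; first last.
- by move=> u uw; rewrite /propagating top_block bot_block w_neq0.
- by move=> X _; rewrite /propagating top_block eqxx.
- by move=> X _; rewrite /propagating bot_block eqxx andbF.
rewrite (eq_map (g := id)) ?map_id // => u.
by rewrite top_block bot_block; case: u.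
Qed.

Let sigma_sort s : perm_eq s sigma -> sort (@ll_le k) s = sigma.
Proof.
apply: sort_perm_sorted.
- exact: ll_le_trans.
- move=> X Y Xs Ys; apply: (ll_le_total key_inj); rewrite mem_cat ?Xs ?Ys //.
- by move=> X Y _ _; apply: ll_le_anti.
- exact: (sorted_filter (@ll_le_trans k)).
Qed.

Let mirror_top : top_blocks mirror_diagram = sigma.
Proof.
apply: sigma_sort; apply: perm_trans (perm_mirror _ _) _.
rewrite (mirror_filter (p := fun B => bot_part B == set0)
  (b1 := true) (b2 := false) (b3 := false)) ?cats0; first last.
- by move=> u /w_neq0/andP[_ /negPf]; rewrite bot_block.
- by move=> X; rewrite bot_block mem_filter => /andP[/negPf].
- by move=> X _; rewrite bot_block eqxx.
by rewrite -map_comp (eq_map (g := id)) ?map_id // => X; rewrite /= top_block.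
Qed.

Let mirror_bot : bot_blocks mirror_diagram = sigma.
Proof.
apply: sigma_sort; apply: perm_trans (perm_mirror _ _) _.
rewrite (mirror_filter (p := fun B => top_part B == set0)
  (b1 := false) (b2 := true) (b3 := false)) ?cats0; first last.
- by move=> u /w_neq0/andP[/negPf]; rewrite top_block.
- by move=> X _; rewrite top_block eqxx.
- by move=> X; rewrite top_block mem_filter => /andP[/negPf].
by rewrite -map_comp (eq_map (g := id)) ?map_id // => X; rewrite /= bot_block.
Qed.

Let first_row_split m : m = n - size w ->
  nseq (m - size sigma) set0 ++ sigma = first_row S.
Proof.
(* The empty sets come first in the sorted first row, and their number is
   dictated by the total number of cells. *)
move=> ->; have -> : size w = size (flatten Q) by rewrite -(perm_size w_top) size_map.
rewrite -S_size [in size (flatten S)]S_split /= size_cat addnK /sigma.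
move: (first_row S) first_sorted; elim=> [|X r IH] //= /[dup] sX /path_sorted/IH {}IH.
have [->|X0] /= := eqVneq X set0.
  by rewrite subSn ?size_filter ?count_size //= -size_filter IH.
have /all_filterP-> : all (fun Y => Y != set0) r; last by rewrite subnn.
apply/allP=> Y Yr; rewrite -last_letter_gt0; move: X0; rewrite -last_letter_gt0.
move=> /leq_trans; apply; apply: ll_leW.
by have /allP := order_path_min (@ll_le_trans k) sX; apply.
Qed.

Lemma mirror_insertion : insertion n mirror_diagram = (S, S).
Proof.
rewrite /insertion mirror_biword w_rsk mirror_top mirror_bot /add_first_row.
by rewrite first_row_split // -S_split.
Qed.

End Mirror.
Section Realization.
Variable k : nat.
Local Notation key := (@last_letter k).
Implicit Types (la : seq nat) (S t : tableau k) (X Y Z : {set 'I_k}).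

Lemma flatten_first_row t : flatten t = first_row t ++ flatten (behead t).
Proof. by case: t. Qed.

Lemma mem_rows t r X : r \in t -> X \in r -> X \in flatten t.
Proof. by move=> rt Xr; apply/flattenP; exists r. Qed.

Lemma standard_lower_neq0 la t : standard_multiset_tableau la t ->
  set0 \notin flatten (behead t).
Proof.
case=> _ _ _ cols; apply/flattenP=> -[r /(nthP [::])[i]].
rewrite size_behead nth_behead => i_lt <- /(nthP set0)[j j_lt eq0].
have := cols i j; rewrite /ll_lt /entry eq0 -ltn_predRL => /(_ i_lt j_lt).
by move/(leq_trans (ltn0Sn _)); rewrite last_letter_gt0 eqxx.
Qed.

Lemma standard_semistandard n la t : is_partition_of n la ->
  standard_multiset_tableau la t -> semistandard (behead t).
Proof.
case/and3P=> la_sorted la_neq0 _ [sh _ rows cols]; apply/andP; split.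
  apply/allP=> r /mem_behead rt; apply/andP; split.
    by apply: contra la_neq0 => /eqP r0; rewrite -sh -r0; apply: (map_f size).
  by apply: sub_sorted (rows r rt) => X Y; apply: ll_leW.
apply/(sortedP [::]) => i; rewrite size_behead !nth_behead => i_lt.
have i2 : i.+2 < size t by lia.
apply/belowP; split; last by move=> j j_lt; apply: cols.
have /(sortedP 0)/(_ i.+1) := la_sorted; rewrite -sh size_map => /(_ i2).
by rewrite !(nth_map [::]) // ltnW.
Qed.

Variant mirror_block S : {set 'I_k + 'I_k} -> Prop :=
| MirrorTop X of X \in first_row S & X != set0 : mirror_block S (block (X, set0))
| MirrorBot X of X \in first_row S & X != set0 : mirror_block S (block (set0, X))
| MirrorProp Y Z of Y \in flatten (behead S) & Z \in flatten (behead S)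
    & (size S <= 2 -> Y = Z) : mirror_block S (block (Y, Z)).

(** RSK provides the propagating blocks for an arbitrary [S].  When [S] has at
    most two rows they are instead taken symmetric under the exchange of the rows
    of the diagram, because the planar classes need to know that they do not
    cross. *)
Lemma standard_realized n la S : is_partition_of n la -> 0 < n ->
    standard_multiset_tableau la S ->
  exists pi : diagram k, [/\ is_diagram pi, insertion n pi = (S, S) &
    forall B, B \in pi -> mirror_block S B].
Proof.
move=> la_n n_gt0 stdS; have [sh cover1 rows _] := stdS.
have Q_neq0 := standard_lower_neq0 stdS; have ssQ := standard_semistandard la_n stdS.
have sizeS : size (flatten S) = n.
  by rewrite size_flatten sh; case/and3P: la_n => _ _ /eqP.
have S_ne : S = first_row S :: behead S.
  by case: (S) sizeS n_gt0 => //= <-.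
have first_sorted : sorted (@ll_le k) (first_row S).
  by apply: rows; rewrite [S in _ \in S]S_ne mem_head.
have Q_inj : {in flatten (behead S) &, injective key}.
  move=> X Y XQ YQ eqXY; have X0 : X != set0 by apply: contraNneq Q_neq0 => <-.
  have [c cX cY] := eq_last_letter X0 eqXY.
  apply: (exact_cover_inj cover1 _ _ cX cY);
  by rewrite flatten_first_row mem_cat (XQ, YQ) orbT.
suff [w [w_rsk w_top w_bot w_sorted w_diag]] : exists w,
    [/\ rsk w = (behead S, behead S), perm_eq (unzip1 w) (flatten (behead S)),
        perm_eq (unzip2 w) (flatten (behead S)), pairwise (relpre key leq) (unzip1 w)
      & {in w, forall u, size S <= 2 -> u.1 = u.2}].
  exists (mirror_diagram S w); split.
  - exact: (mirror_is_diagram cover1 sizeS).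
  - exact: mirror_insertion.
  move=> B; rewrite inE => /mapP[u + ->]; rewrite !mem_cat.
  case/or3P => [/mapP[X]|/mapP[X]|uw].
  - by rewrite mem_filter => /andP[X0 XS] ->; apply: MirrorTop.
  - by rewrite mem_filter => /andP[X0 XS] ->; apply: MirrorBot.
  - move: (w_diag u uw); have := map_f fst uw; have := map_f snd uw; case: u {uw} => Y Z.
    by rewrite (perm_mem w_top) (perm_mem w_bot) => ZQ YQ eqYZ; apply: MirrorProp.
have [S_le2|S_gt2] := leqP (size S) 2; last first.
  have [//|w [w1 w2 w3 w4]] := rsk_onto Q_inj ssQ ssQ; exists w; split=> // u _.
pose r := flatten (behead S); have Q_row : behead S = one_row r.
  rewrite /r; case: (S) S_le2 ssQ => [|s [|s' [|]]] //= _.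
  by rewrite semistandard_cons cats0 /row_ok /one_row => /andP[/andP[/negPf->]].
have unzip1r : unzip1 [seq (X, X) | X <- r] = r by rewrite /unzip1 -map_comp map_id_in.
have unzip2r : unzip2 [seq (X, X) | X <- r] = r by rewrite /unzip2 -map_comp map_id_in.
have r_sorted : pairwise (@ll_le k) r.
  rewrite -(sorted_pairwise (@ll_le_trans k)) /r.
  case: (S) S_le2 rows => [|s [|s' [|]]] //= _ rows; rewrite cats0.
  by apply: rows; rewrite !inE eqxx orbT.
exists [seq (X, X) | X <- r]; rewrite unzip1r unzip2r; split=> //.
- by rewrite rsk_increasing ?unzip2r // unzip1r -Q_row.
- by apply: sub_pairwise r_sorted => X Y; apply: ll_leW.
- by move=> _ /mapP[X _ ->].
Qed.

End Realization.

(** * Entries of the insertion tableaux *)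

Section Entries.
Variable k : nat.
Local Notation key := (@last_letter k).
Implicit Types (pi : diagram k) (B C : {set 'I_k + 'I_k}) (P t : tableau k).

(** Were two entries to share their last letter, a bumping step could find no
    entry to replace and would send an empty set downwards. *)
Lemma row_insert_entries (D : {pred {set 'I_k}}) x P :
    {in D &, injective key} -> x \in D -> {subset flatten P <= D} ->
  {subset flatten (row_insert x P).1 <= D}.
Proof.
move=> inj; elim: P x => [|r P IH] x xD PD /=; first by move=> y; rewrite inE => /eqP->.
have rD y : y \in r -> y \in D by move=> yr; apply: PD; rewrite /= mem_cat yr.
have {}PD y : y \in flatten P -> y \in D.
  by move=> yP; apply: PD; rewrite /= mem_cat yP orbT.
case: ifP => [_ y|/negbT/allPn[y yr]] /=.
  by rewrite mem_cat mem_rcons inE => /orP[/orP[/eqP->|/rD]|/PD].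
rewrite (ll_leE inj (rD y yr) xD) -ltnNge => xy.
have x_lt : has (ll_lt x) r by apply/hasP; exists y.
have := IH (nth set0 r (find (ll_lt x) r)).
case: row_insert => P' i /= IHx z; rewrite mem_cat => /orP[|/IHx]; last first.
  by apply=> //; apply/rD/mem_nth; rewrite -has_find.
rewrite set_nthE -has_find x_lt mem_cat inE => /or3P[/mem_take/rD|/eqP->|/mem_drop/rD] //.
Qed.

Lemma rsk_entries (D : {pred {set 'I_k}}) w : {in D &, injective key} ->
    {subset unzip2 w <= D} ->
  {subset flatten (rsk w).1 <= D} /\ {subset flatten (rsk w).2 <= unzip1 w}.
Proof.
move=> inj; elim/last_ind: w => [|w [a b] IH] //.
rewrite /unzip2 map_rcons => wD; have [|IH1 IH2] := IH.
  by move=> y yw; apply: wD; rewrite mem_rcons inE yw orbT.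
have bD : b \in D by apply: wD; rewrite mem_rcons mem_head.
have := row_insert_entries inj bD IH1.
rewrite rsk_rcons /rsk_step /=; case: row_insert => P i /= PD; split=> // y.
rewrite /unzip1 map_rcons mem_rcons inE => /flattenP[r].
rewrite /record_at; move: (rsk w).2 IH2 => Q QD rQ yr.
have {r rQ yr} : (y \in rcons (nth [::] Q i) a) || (y \in flatten Q).
  move: rQ; rewrite set_nthE; case: ltnP => _; rewrite mem_cat ?inE.
    case/or3P=> [/mem_take rQ|/eqP<-|/mem_drop rQ]; rewrite ?yr //.
      by rewrite (mem_rows rQ yr) orbT.
    by rewrite (mem_rows rQ yr) orbT.
  case/orP=> [rQ|]; first by rewrite (mem_rows rQ yr) orbT.
  rewrite /ncons; elim: (_ - _) => [|m IHm] /=; rewrite inE.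
    by move/eqP=> <-; rewrite yr.
  by case/orP=> // /eqP r0; rewrite r0 in yr.
rewrite mem_rcons inE -orbA => /or3P[->//|yQ|/QD->]; last by rewrite orbT.
rewrite QD ?orbT //; case: (ltnP i (size Q)) => i_lt.
  exact: mem_rows (mem_nth _ i_lt) yQ.
by rewrite nth_default in yQ.
Qed.

(** All that the classes need to know about an insertion tableau: its entries are
    traces of blocks on one row of the diagram.  [p] takes the trace on that row
    and [p'] the trace on the other, so that both tableaux are treated alike. *)
Definition reads (p p' : {set 'I_k + 'I_k} -> {set 'I_k}) pi t :=
  (exists m s, [/\ first_row t = nseq m set0 ++ s, uniq s &
     forall X, X \in s -> exists B, [/\ B \in pi, X = p B & p' B = set0]]) /\
  (forall X, X \in flatten (behead t) ->
     exists B, [/\ B \in pi, X = p B, p B != set0 & p' B != set0]).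

Lemma diagram_block_eq pi B C v : is_diagram pi -> B \in pi -> C \in pi ->
  v \in B -> v \in C -> B = C.
Proof.
case/and3P=> _ /trivIsetP triv _ Bpi Cpi vB vC; apply/eqP.
by apply: contraTT vC => /(triv B C Bpi Cpi) dis; rewrite (disjointFr dis vB).
Qed.

Lemma mem_propagating_biword pi u : u \in propagating_biword pi ->
  exists B, [/\ B \in pi, u.1 = top_part B, u.2 = bot_part B & propagating B].
Proof.
rewrite mem_sort => /mapP[B]; rewrite mem_filter mem_enum => /andP[prB Bpi] ->.
by exists B.
Qed.

Lemma top_part_inj pi : is_diagram pi ->
  {in pi &, forall B C, top_part B != set0 ->
    key (top_part B) = key (top_part C) -> B = C}.
Proof.
move=> dpi B C Bpi Cpi B0 /(eq_last_letter B0)[c]; rewrite !inE.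
exact: (diagram_block_eq dpi Bpi Cpi).
Qed.

Lemma bot_part_inj pi : is_diagram pi ->
  {in pi &, forall B C, bot_part B != set0 ->
    key (bot_part B) = key (bot_part C) -> B = C}.
Proof.
move=> dpi B C Bpi Cpi B0 /(eq_last_letter B0)[c]; rewrite !inE.
exact: (diagram_block_eq dpi Bpi Cpi).
Qed.

Lemma insertion_reads n pi : is_diagram pi ->
  reads (@top_part k) (@bot_part k) pi (insertion n pi).2 /\
  reads (@bot_part k) (@top_part k) pi (insertion n pi).1.
Proof.
move=> dpi; set w := propagating_biword pi.
have inj : {in unzip2 w &, injective key}.
  move=> X Y /mapP[u /mem_propagating_biword[B [Bpi _ -> /andP[_ B0]]] ->].
  move=> /mapP[v /mem_propagating_biword[C [Cpi _ -> _]] ->].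
  by move/(bot_part_inj dpi Bpi Cpi B0)->.
have [PD QD] := rsk_entries inj (fun y yw => yw).
rewrite /insertion -/w; case: (rsk w) PD QD => P Q /= PD QD; split; split.
- exists (n - size w - size (top_blocks pi)), (top_blocks pi); split=> //.
    rewrite sort_uniq map_inj_in_uniq ?(filter_uniq _ (enum_uniq _)) // => B C.
    rewrite !mem_filter => /andP[/eqP B0 _] /andP[/eqP C0 _] eqBC.
    by rewrite -(block_parts B) -(block_parts C) eqBC B0 C0.
  move=> X; rewrite mem_sort => /mapP[B]; rewrite mem_filter mem_enum.
  by case/andP=> /eqP B0 Bpi ->; exists B.
- move=> X /QD/mapP[u /mem_propagating_biword[B [Bpi -> _ /andP[B1 B2]]] ->].
  by exists B.
- exists (n - size w - size (bot_blocks pi)), (bot_blocks pi); split=> //.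
    rewrite sort_uniq map_inj_in_uniq ?(filter_uniq _ (enum_uniq _)) // => B C.
    rewrite !mem_filter => /andP[/eqP B0 _] /andP[/eqP C0 _] eqBC.
    by rewrite -(block_parts B) -(block_parts C) eqBC B0 C0.
  move=> X; rewrite mem_sort => /mapP[B]; rewrite mem_filter mem_enum.
  by case/andP=> /eqP B0 Bpi ->; exists B.
- move=> X /PD/mapP[u /mem_propagating_biword[B [Bpi _ -> /andP[B1 B2]]] ->].
  by exists B.
Qed.

Section Reads.
Variables (p p' : {set 'I_k + 'I_k} -> {set 'I_k}) (pi : diagram k) (t : tableau k).
Hypothesis t_reads : reads p p' pi t.

Lemma reads_first_row X : X \in first_row t ->
  X = set0 \/ exists B, [/\ B \in pi, X = p B & p' B = set0].
Proof.
have [[m [s [-> _ sP]]] _] := t_reads; rewrite mem_cat => /orP[|/sP]; last by right.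
by rewrite mem_nseq => /andP[_ /eqP]; left.
Qed.

Hypothesis card_p : forall B, #|B| = #|p B| + #|p' B|.

Lemma reads_matching : matching pi -> matching_tableau t.
Proof.
move=> match_pi; split=> [X /reads_first_row[->|[B [Bpi -> _]]]|r X rt Xr].
- by rewrite cards0.
- by apply: leq_trans (match_pi B Bpi); rewrite card_p leq_addr.
have [_ /(_ X (mem_rows rt Xr))[B [Bpi ->]]] := t_reads.
by rewrite -!card_gt0; have := match_pi B Bpi; rewrite card_p; lia.
Qed.

Lemma reads_sizes (s : seq nat) : 0 \in s ->
    (forall B, B \in pi -> p' B = set0 -> #|B| \in s) ->
  first_row_sizes s t.
Proof.
move=> s0 sizes X /reads_first_row[->|[B [Bpi -> B0]]]; first by rewrite cards0.
by have := sizes B Bpi B0; rewrite card_p B0 cards0 addn0.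
Qed.

End Reads.

End Entries.
(** * Planarity *)

Section Planarity.
Variable k : nat.
Local Notation key := (@last_letter k).
Implicit Types (pi : diagram k) (B C : {set 'I_k + 'I_k}) (X Y Z : {set 'I_k}).

Lemma noncrossingP m (X Y : {set 'I_m}) : reflect
  (forall a b c d, a \in X -> b \in X -> c \in Y -> d \in Y ->
     ~ [\/ [&& a < c, c < b & b < d] | [&& c < a, a < d & d < b]])
  (noncrossing X Y).
Proof.
apply: (iffP idP) => [nc a b c d aX bX cY dY cross|nc].
  apply: (negP nc); apply/exists_inP; exists a => //; apply/exists_inP; exists b => //.
  apply/exists_inP; exists c => //; apply/exists_inP; exists d => //; exact/orP.
apply/negP=> /exists_inP[a aX /exists_inP[b bX /exists_inP[c cY /exists_inP[d dY]]]].
by move/orP; apply: nc.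
Qed.

Lemma noncrossing_sym m : symmetric (@noncrossing m).
Proof.
by move=> X Y; apply/noncrossingP/noncrossingP=> nc a b c d aX bX cY dY [] h;
  apply: (nc c d a b cY dY aX bX); [right|left|right|left].
Qed.

Lemma noncrossing0 m (X : {set 'I_m}) : noncrossing set0 X.
Proof. by apply/noncrossingP=> a b c d; rewrite inE. Qed.

Lemma betweenP (c : 'I_k) X : reflect
  (exists a b, [/\ a \in X, b \in X & a < c < b]) (between c X).
Proof.
apply: (iffP exists_inP) => [[a aX /exists_inP[b bX h]]|[a [b [aX bX h]]]].
  by exists a, b.
by exists a => //; apply/exists_inP; exists b.
Qed.

(** The number underlying [boundary_pos], in a form open to linear arithmetic. *)
Definition pos (v : 'I_k + 'I_k) : nat :=
  match v with inl i => i | inr i => k + (k - i.+1) end.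

Definition blocks_noncrossing B C :=
  noncrossing ((@boundary_pos k) @: B) ((@boundary_pos k) @: C).

Lemma blocks_noncrossingP B C : reflect
  (forall a b c d, a \in B -> b \in B -> c \in C -> d \in C ->
     ~ [\/ [&& pos a < pos c, pos c < pos b & pos b < pos d]
        | [&& pos c < pos a, pos a < pos d & pos d < pos b]])
  (blocks_noncrossing B C).
Proof.
have posE v : pos v = boundary_pos v :> nat by case: v.
apply: (iffP (noncrossingP _ _)) => [nc a b c d aB bB cC dC|nc a b c d].
  by rewrite !posE; apply: nc; apply: imset_f.
case/imsetP=> a' aB -> /imsetP[b' bB ->] /imsetP[c' cC ->] /imsetP[d' dC ->].
by rewrite -!posE; apply: nc.
Qed.

Section PlanarDiagram.
Variable pi : diagram k.
Hypotheses (dpi : is_diagram pi) (planar_pi : planar_diagram pi).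

Lemma planar_top_noncrossing :
  {in pi &, forall B C, B != C -> noncrossing (top_part B) (top_part C)}.
Proof.
move=> B C Bpi Cpi neqBC; apply/noncrossingP=> a b c d; rewrite !inE => aB bB cC dC.
by have /blocks_noncrossingP/(_ _ _ _ _ aB bB cC dC) := planar_pi Bpi Cpi neqBC.
Qed.

(** The boundary is traversed from right to left along the bottom row, so the
    four letters of a crossing appear there in the opposite order. *)
Lemma planar_bot_noncrossing :
  {in pi &, forall B C, B != C -> noncrossing (bot_part B) (bot_part C)}.
Proof.
move=> B C Bpi Cpi neqBC; apply/noncrossingP=> a b c d; rewrite !inE => aB bB cC dC h.
have /blocks_noncrossingP/(_ _ _ _ _ bB aB dC cC) := planar_pi Bpi Cpi neqBC; apply.
have := ltn_ord a; have := ltn_ord b; have := ltn_ord c; have := ltn_ord d.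
by case: h => h; [right|left]; rewrite /=; lia.
Qed.

(** A propagating block that has the letter [c] between two letters of another
    block crosses it on the way from [c] to the other row. *)
Lemma planar_top_between : {in pi &, forall B C (c : 'I_k), B != C -> c \in top_part B ->
  bot_part B != set0 -> ~~ between c (top_part C)}.
Proof.
move=> B C Bpi Cpi c neqBC; rewrite inE => cB /set0Pn[d]; rewrite inE => dB.
apply/betweenP=> -[a [b []]]; rewrite !inE => aC bC h.
have /blocks_noncrossingP/(_ _ _ _ _ cB dB aC bC) := planar_pi Bpi Cpi neqBC; apply.
by right; rewrite /=; have := ltn_ord d; have := ltn_ord b; lia.
Qed.

Lemma planar_bot_between : {in pi &, forall B C (c : 'I_k), B != C -> c \in bot_part B ->
  top_part B != set0 -> ~~ between c (bot_part C)}.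
Proof.
move=> B C Bpi Cpi c neqBC; rewrite inE => cB /set0Pn[d]; rewrite inE => dB.
apply/betweenP=> -[a [b []]]; rewrite !inE => aC bC h.
have /blocks_noncrossingP/(_ _ _ _ _ dB cB bC aC) := planar_pi Bpi Cpi neqBC; apply.
left; rewrite /=.
by have := ltn_ord d; have := ltn_ord b; have := ltn_ord a; have := ltn_ord c; lia.
Qed.

(** Propagating blocks of a planar diagram succeed one another from left to
    right, in the top row and in the bottom row alike. *)
Lemma planar_biword_sorted : pairwise (@ll_le k) (unzip2 (propagating_biword pi)).
Proof.
have biword := @mem_propagating_biword k pi.
set w := propagating_biword pi in biword *.
have w_top : {in w & , forall u v, ll_le u.1 v.1 || ll_le v.1 u.1}.
  move=> u v /biword[B [Bpi -> _ /andP[B0 _]]] /biword[C [Cpi -> _ _]].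
  case: (ltngtP (key (top_part B)) (key (top_part C))) => [lt|lt|].
  - by rewrite /ll_le /ll_lt lt orbT.
  - by rewrite /ll_le /ll_lt lt !orbT.
  - by move/(top_part_inj dpi Bpi Cpi B0)=> ->; rewrite /ll_le eqxx.
have w_sorted : pairwise (fun u v => ll_le u.1 v.1) w.
  rewrite -sorted_pairwise; last by move=> u v t; apply: ll_le_trans.
  apply: (sort_sorted_in (P := mem w)); first exact: w_top.
  by apply/allP=> u u_in; have : u \in w by rewrite mem_sort.
rewrite /unzip2 pairwise_map.
apply: (@sub_in_pairwise _ (mem w)) w_sorted; last exact/allP.
move=> u v /biword[B [Bpi -> /= -> /andP[B1 B2]]].
case/biword=> C [Cpi -> -> /andP[C1 C2]] /= le_top.
have [->|neqBC] := eqVneq B C; first by rewrite /ll_le eqxx.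
have [a aB Ba] := last_letter_mem B1; have [c cC Cc] := last_letter_mem C1.
have [b bB Bb] := last_letter_mem B2; have [d dC Cd] := last_letter_mem C2.
rewrite !inE in aB cC bB dC.
have ac : a < c.
  rewrite ltn_neqAle -ltnS -Ba -Cc (ll_leW le_top) andbT; apply/eqP=> eq_ac.
  by case/eqP: neqBC; apply: (diagram_block_eq dpi Bpi Cpi aB); rewrite (val_inj eq_ac).
apply/orP; right; rewrite /ll_lt Bb Cd ltnS ltnNge.
apply/negP; rewrite leq_eqVlt => /orP[/eqP eq_bd|bd].
  by case/eqP: neqBC; apply: (diagram_block_eq dpi Bpi Cpi bB); rewrite -(val_inj eq_bd).
have /blocks_noncrossingP/(_ _ _ _ _ aB bB cC dC) := planar_pi Bpi Cpi neqBC; apply.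
left; rewrite /=; clear -ac bd.
by have := ltn_ord d; have := ltn_ord b; have := ltn_ord c; lia.
Qed.

Lemma planar_insertion_size n :
  size (insertion n pi).1 <= 2 /\ size (insertion n pi).2 <= 2.
Proof.
rewrite /insertion rsk_increasing; last exact: planar_biword_sorted.
by rewrite /one_row; split; rewrite /=; case: ifP.
Qed.

End PlanarDiagram.

Lemma reads_planar (p p' : {set 'I_k + 'I_k} -> {set 'I_k}) pi (t : tableau k) :
    reads p p' pi t -> size t <= 2 ->
    {in pi &, forall B C, B != C -> noncrossing (p B) (p C)} ->
    {in pi &, forall B C (c : 'I_k), B != C -> c \in p B -> p' B != set0 ->
       ~~ between c (p C)} ->
  planar_tableau t.
Proof.
move=> t_reads t_le2 nc nb; have [[m [s [t_first s_uniq sP]]] lowP] := t_reads; split=> //.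
  rewrite t_first pairwise_cat; apply/and3P; split.
  - by apply/allrelP=> X Y; rewrite mem_nseq => /andP[_ /eqP->] _; apply: noncrossing0.
  - apply/(pairwiseP set0) => i j; rewrite !inE !size_nseq !nth_nseq => -> _ _.
    exact: noncrossing0.
  move: s_uniq; rewrite uniq_pairwise; apply: (@sub_in_pairwise _ (mem s)); last exact/allP.
  move=> X Y /sP[B [Bpi -> _]] /sP[C [Cpi -> _]] neq; apply: nc => //.
  by apply: contraNneq neq => ->.
move=> Y X c Y1 cY; rewrite flatten_first_row mem_cat => X_in neqXY.
have Y_low : Y \in flatten (behead t).
  move: Y1; rewrite -nth_behead => Y1; apply: (mem_rows _ Y1); apply: mem_nth.
  by move: Y1; rewrite lt0n; apply: contraTneq => /size0nil->; rewrite nth_nil.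
have [B [Bpi eqY _ B'0]] := lowP Y Y_low.
have [->|[C Cpi eqX]] : X = set0 \/ exists2 C, C \in pi & X = p C.
- case/orP: X_in => [/(reads_first_row t_reads)[->|[C [Cpi -> _]]]|/lowP[C [Cpi -> _ _]]].
  + by left.
  + by right; exists C.
  + by right; exists C.
- by apply/betweenP=> -[a [b []]]; rewrite inE.
rewrite eqX; apply: nb B'0 => //; last by rewrite -eqY.
by apply: contraNneq neqXY => eqBC; rewrite eqX eqY eqBC.
Qed.

Lemma top_top_noncrossing X Y : noncrossing X Y ->
  blocks_noncrossing (block (X, set0)) (block (Y, set0)).
Proof.
move/noncrossingP=> nc; apply/blocks_noncrossingP=> -[] a [] b [] c [] d; rewrite !inE //.
exact: nc.
Qed.

Lemma bot_bot_noncrossing X Y : noncrossing X Y ->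
  blocks_noncrossing (block (set0, X)) (block (set0, Y)).
Proof.
move/noncrossingP=> nc; apply/blocks_noncrossingP=> -[] a [] b [] c [] d; rewrite !inE //=.
move=> aX bX cY dY h; apply: (nc b a d c) => //.
have := ltn_ord a; have := ltn_ord b; have := ltn_ord c; have := ltn_ord d.
by case: h => h; [right|left]; lia.
Qed.

Lemma top_bot_noncrossing X Y : blocks_noncrossing (block (X, set0)) (block (set0, Y)).
Proof.
apply/blocks_noncrossingP=> -[] a [] b [] c [] d; rewrite !inE //= => _ _ _ _.
by have := ltn_ord a; have := ltn_ord b => ? ? []; lia.
Qed.

Lemma notbetween X Y : (forall c, c \in Y -> ~~ between c X) ->
  forall a b c, a \in X -> b \in X -> c \in Y -> ~ (a < c < b).
Proof. by move=> nb a b c aX bX cY h; case/negP: (nb c cY); apply/betweenP; exists a, b. Qed.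

(** A crossing needs a letter of the propagating block between two letters of
    [X]: those in the other row all lie on the same side of [X]. *)
Lemma top_prop_noncrossing X Y : (forall c, c \in Y -> ~~ between c X) ->
  blocks_noncrossing (block (X, set0)) (block (Y, Y)).
Proof.
move/notbetween=> nb; apply/blocks_noncrossingP=> -[] a [] b [] c [] d; rewrite !inE //=
  => aX bX cY dY;
have := nb a b c aX bX cY; have := nb a b d aX bX dY;
have := ltn_ord a; have := ltn_ord b; by move=> ? ? ? ? []; lia.
Qed.

Lemma bot_prop_noncrossing X Y : (forall c, c \in Y -> ~~ between c X) ->
  blocks_noncrossing (block (set0, X)) (block (Y, Y)).
Proof.
move/notbetween=> nb; apply/blocks_noncrossingP=> -[] a [] b [] c [] d; rewrite !inE //=
  => aX bX cY dY;
have := nb b a c bX aX cY; have := nb b a d bX aX dY;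
have := ltn_ord a; have := ltn_ord b; have := ltn_ord c; have := ltn_ord d;
by move=> ? ? ? ? ? ? []; lia.
Qed.

(** Neither set reaches between two letters of the other, so that one of them lies
    wholly to the left of the other, in both rows of the diagram. *)
Lemma prop_prop_noncrossing Y Z : [disjoint Y & Z] ->
    (forall c, c \in Y -> ~~ between c Z) -> (forall c, c \in Z -> ~~ between c Y) ->
  blocks_noncrossing (block (Y, Y)) (block (Z, Z)).
Proof.
move=> dis /notbetween nbZ /notbetween nbY.
have neq (a c : 'I_k) : a \in Y -> c \in Z -> a <> c :> nat.
  by move=> aY cZ /val_inj eq_ac; rewrite -eq_ac (disjointFr dis aY) in cZ.
have same_side (a b c d : 'I_k) : a \in Y -> b \in Y -> c \in Z -> d \in Z ->
   (a < c) = (b < d).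
  move=> aY bY cZ dZ; have := neq a c aY cZ; have := neq b d bY dZ.
  have := neq a d aY dZ; have := neq b c bY cZ.
  have := nbY a b c aY bY cZ; have := nbY a b d aY bY dZ.
  have := nbY b a c bY aY cZ; have := nbY b a d bY aY dZ.
  have := nbZ c d a cZ dZ aY; have := nbZ c d b cZ dZ bY.
  have := nbZ d c a dZ cZ aY; have := nbZ d c b dZ cZ bY.
  lia.
apply/blocks_noncrossingP=> -[] a [] b [] c [] d; rewrite !inE /= => aY bY cZ dZ;
have := same_side a b c d aY bY cZ dZ; have := same_side a b d c aY bY dZ cZ;
have := neq a c aY cZ; have := neq b d bY dZ; have := neq a d aY dZ; have := neq b c bY cZ;
have := ltn_ord a; have := ltn_ord b; have := ltn_ord c; have := ltn_ord d;
by move=> ? ? ? ? ? ? ? ? ? ? []; lia.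
Qed.

Lemma mirror_planar la (S : tableau k) pi : standard_multiset_tableau la S ->
    planar_tableau S -> (forall B, B \in pi -> mirror_block S B) ->
  planar_diagram pi.
Proof.
move=> stdS [S_le2 S_nc S_nb] piS.
have second X : X \in flatten (behead S) -> X \in nth [::] S 1.
  by case: (S) S_le2 => [|s [|s' [|]]] //= _; rewrite cats0.
have Snc : {in first_row S &, forall X Y, X != Y -> noncrossing X Y}.
  move=> X Y /(nthP set0)[i iS <-] /(nthP set0)[j jS <-] neq.
  have /(pairwiseP set0) nc := S_nc.
  case: (ltngtP i j) => [ij|ji|eq_ij]; first exact: nc.
    by rewrite noncrossing_sym; apply: nc.
  by rewrite eq_ij eqxx in neq.
have [_ cover1 _ _] := stdS.
have low_neq0 := standard_lower_neq0 stdS.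
have upper X : X \in first_row S -> X \in flatten S.
  by rewrite flatten_first_row mem_cat => ->.
have lower X : X \in flatten (behead S) -> X \in flatten S.
  by move=> XS; rewrite flatten_first_row mem_cat XS orbT.
have low_nb X Y c : X \in flatten S -> Y \in flatten (behead S) -> X != Y -> c \in Y ->
    ~~ between c X.
  by move=> XS YS neq cY; apply: (S_nb Y) => //; apply: second.
(* A set of the first row and a lower one cannot coincide, for their letters
   would be covered twice; so the conditions on [S] apply to them. *)
have first_low X Y : X \in first_row S -> Y \in flatten (behead S) -> X != Y.
  move=> XS YS; apply/eqP=> eqXY; have /set0Pn[c cY] : Y != set0.
    by apply: contraNneq low_neq0 => <-.
  have := cover1 c; rewrite flatten_first_row count_cat.
  have : 0 < count (fun Z : {set 'I_k} => c \in Z) (first_row S).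
    by rewrite -has_count; apply/hasP; exists X; rewrite // eqXY.
  have : 0 < count (fun Z : {set 'I_k} => c \in Z) (flatten (behead S)).
    by rewrite -has_count; apply/hasP; exists Y.
  by case: (count _ _) (count _ _) => [|m] [|m'] //; rewrite addnS.
have first_prop X Y c : X \in first_row S -> Y \in flatten (behead S) -> c \in Y ->
    ~~ between c X.
  by move=> XS YS; apply: low_nb => //; [apply: upper|apply: first_low].
have b_sym B C : blocks_noncrossing B C -> blocks_noncrossing C B.
  by rewrite /blocks_noncrossing noncrossing_sym.
move=> B C /piS kindB /piS kindC; rewrite -/(blocks_noncrossing B C).
case: kindB => [X XS _|X XS _|Y Y' YS _ eqY]; case: kindC => [Z ZS _|Z ZS _|Z Z' ZS _ eqZ].
- by rewrite (inj_eq (@block_inj k)) xpair_eqE eqxx andbT => neq; apply/top_top_noncrossing/Snc.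
- by move=> _; apply: top_bot_noncrossing.
- by move=> _; rewrite -eqZ //; apply: top_prop_noncrossing => c; apply: first_prop.
- by move=> _; apply: b_sym; apply: top_bot_noncrossing.
- by rewrite (inj_eq (@block_inj k)) xpair_eqE eqxx => neq; apply/bot_bot_noncrossing/Snc.
- by move=> _; rewrite -eqZ //; apply: bot_prop_noncrossing => c; apply: first_prop.
- move=> _; rewrite -eqY //; apply: b_sym; apply: top_prop_noncrossing => c.
  exact: first_prop.
- move=> _; rewrite -eqY //; apply: b_sym; apply: bot_prop_noncrossing => c.
  exact: first_prop.
rewrite -eqY // -eqZ // (inj_eq (@block_inj k)) xpair_eqE andbb => neq.
apply: prop_prop_noncrossing => [|c cY|c cZ].
- rewrite -setI_eq0; apply: contraNT neq => /set0Pn[c /setIP[cY cZ]]; apply/eqP.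
  by apply: (exact_cover_inj cover1 _ _ cY cZ); apply: lower.
- by apply: (low_nb _ Y) => //; [apply: lower|rewrite eq_sym].
- by apply: (low_nb _ Z) => //; apply: lower.
Qed.

End Planarity.
(** * The nine classes *)

(** A single realizing diagram serves for both halves of the claim, as both of
    its insertion tableaux are the given one. *)
Lemma insertion_tableaux_intro k n la (D : diagram k -> Prop) (C : tableau k -> Prop) :
    is_partition_of n la -> 0 < n ->
    (forall pi, is_diagram pi -> D pi -> C (insertion n pi).1 /\ C (insertion n pi).2) ->
    (forall S (pi : diagram k), standard_multiset_tableau la S -> C S ->
      (forall B, B \in pi -> mirror_block S B) -> D pi) ->
  insertion_tableaux_are n la D C.
Proof.
move=> la_n n_gt0 DC CD; split=> S stdS; split=> [[pi [dpi Dpi <-]]|CS].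
- by have [] := DC pi dpi Dpi.
- have [pi [dpi eqS piS]] := standard_realized la_n n_gt0 stdS; exists pi.
  by split; [|exact: CD piS|rewrite eqS].
- by have [] := DC pi dpi Dpi.
- have [pi [dpi eqS piS]] := standard_realized la_n n_gt0 stdS; exists pi.
  by split; [|exact: CD piS|rewrite eqS].
Qed.

Section Classes.
Variable k : nat.
Implicit Types (pi : diagram k) (S : tableau k) (B : {set 'I_k + 'I_k}).

Lemma insertion_planar n pi : is_diagram pi -> planar_diagram pi ->
  planar_tableau (insertion n pi).1 /\ planar_tableau (insertion n pi).2.
Proof.
move=> dpi planar_pi; have [readsS readsT] := insertion_reads n dpi.
have [T_le2 S_le2] := planar_insertion_size dpi planar_pi n; split.
  apply: reads_planar readsT T_le2 _ _; first exact: planar_bot_noncrossing.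
  exact: planar_bot_between.
apply: reads_planar readsS S_le2 _ _; first exact: planar_top_noncrossing.
exact: planar_top_between.
Qed.

Lemma insertion_matching n pi (s : seq nat) : is_diagram pi -> matching pi -> 0 \in s ->
    (forall B, B \in pi -> ~~ propagating B -> #|B| \in s) ->
  (matching_tableau (insertion n pi).1 /\ first_row_sizes s (insertion n pi).1) /\
  (matching_tableau (insertion n pi).2 /\ first_row_sizes s (insertion n pi).2).
Proof.
move=> dpi match_pi s0 sizes; have [readsS readsT] := insertion_reads n dpi.
have cardC B : #|B| = #|bot_part B| + #|top_part B| by rewrite card_parts addnC.
split; split.
- exact: reads_matching readsT cardC match_pi.
- apply: (reads_sizes readsT cardC s0) => B Bpi B0; apply: sizes => //.
  by rewrite /propagating B0 eqxx.
- exact: reads_matching readsS (@card_parts k) match_pi.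
- apply: (reads_sizes readsS (@card_parts k) s0) => B Bpi B0; apply: sizes => //.
  by rewrite /propagating B0 eqxx andbF.
Qed.

(** The form of a block of a matching whose non-propagating blocks have their
    sizes in [s]; size 0 is excluded because [s] always contains it, on account of
    the empty cells. *)
Variant matching_block_spec (s : seq nat) B : Prop :=
| PropagatingPair of #|top_part B| = 1 & #|bot_part B| = 1
| NonPropagatingBlock of #|B| \in s & #|B| != 0.

Lemma matching_blocks S B (s : seq nat) : matching_tableau S -> first_row_sizes s S ->
  mirror_block S B -> matching_block_spec s B.
Proof.
move=> [_ low1] sizes.
have {}low1 X : X \in flatten (behead S) -> #|X| = 1.
  by case/flattenP=> r rS Xr; apply: low1 Xr.
case=> [X XS X0|X XS X0|Y Z YS ZS _].
- have cardX : #|block (X, set0)| = #|X|.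
    by rewrite card_parts top_block bot_block cards0 addn0.
  by apply: NonPropagatingBlock; rewrite cardX ?sizes // cards_eq0.
- have cardX : #|block (set0, X)| = #|X|.
    by rewrite card_parts top_block bot_block cards0.
  by apply: NonPropagatingBlock; rewrite cardX ?sizes // cards_eq0.
- by apply: PropagatingPair; rewrite ?top_block ?bot_block low1.
Qed.

(** Each class of matchings is determined by the sizes [s] allowed for its
    non-propagating blocks, and gives rise to a general and to a planar case. *)
Lemma class_tableaux n la (D : diagram k -> Prop) (s : seq nat) :
    is_partition_of n la -> 0 < n -> 0 \in s ->
    (forall pi, is_diagram pi -> D pi ->
      matching pi /\ forall B, B \in pi -> ~~ propagating B -> #|B| \in s) ->
    (forall pi, (forall B, B \in pi -> matching_block_spec s B) -> D pi) ->
  insertion_tableaux_are n la D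
    (fun t => matching_tableau t /\ first_row_sizes s t) /\
  insertion_tableaux_are n la (fun pi => planar_diagram pi /\ D pi)
    (fun t => [/\ matching_tableau t, planar_tableau t & first_row_sizes s t]).
Proof.
move=> la_n n_gt0 s0 DP PD; split; apply: insertion_tableaux_intro => //.
- by move=> pi dpi /(DP pi dpi)[m sizes]; apply: insertion_matching.
- move=> S pi _ [mS sizes] piS; apply: PD => B /piS; exact: matching_blocks.
- move=> pi dpi [planar_pi /(DP pi dpi)[m sizes]].
  have [[? ?] [? ?]] := insertion_matching n dpi m s0 sizes.
  by have [] := insertion_planar n dpi planar_pi.
- move=> S pi stdS [mS planarS sizes] piS; split.
    exact: mirror_planar stdS planarS piS.
  by apply: PD => B /piS; apply: matching_blocks.
Qed.

End Classes.

Theorem lemma6p6 (k n : nat) (la : seq nat) (hk : 0 < k)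
    (hla : is_partition_of n la) (hn : 2 * k <= n) :
  insertion_tableaux_are n la (@any_diagram k) (fun _ => True) /\
  insertion_tableaux_are n la (@planar_diagram k) (@planar_tableau k) /\
  insertion_tableaux_are n la (@permutation k)
    (fun t => matching_tableau t /\ first_row_sizes [:: 0] t) /\
  insertion_tableaux_are n la (@perfect_matching k)
    (fun t => matching_tableau t /\ first_row_sizes [:: 0; 2] t) /\
  insertion_tableaux_are n la (@partial_permutation k)
    (fun t => matching_tableau t /\ first_row_sizes [:: 0; 1] t) /\
  insertion_tableaux_are n la (@matching k)
    (fun t => matching_tableau t /\ first_row_sizes [:: 0; 1; 2] t) /\
  insertion_tableaux_are n la
    (fun pi : diagram k => planar_diagram pi /\ perfect_matching pi)
    (fun t => [/\ matching_tableau t, planar_tableau t &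
                  first_row_sizes [:: 0; 2] t]) /\
  insertion_tableaux_are n la
    (fun pi : diagram k => planar_diagram pi /\ matching pi)
    (fun t => [/\ matching_tableau t, planar_tableau t &
                  first_row_sizes [:: 0; 1; 2] t]) /\
  insertion_tableaux_are n la
    (fun pi : diagram k => planar_diagram pi /\ partial_permutation pi)
    (fun t => [/\ matching_tableau t, planar_tableau t &
                  first_row_sizes [:: 0; 1] t]).
Proof.
have n_gt0 : 0 < n by apply: leq_trans hn; rewrite muln_gt0.
have card_pair (B : {set 'I_k + 'I_k}) :
    #|top_part B| = 1 -> #|bot_part B| = 1 -> #|B| = 2 /\ propagating B.
  by rewrite card_parts /propagating -!card_gt0 => -> ->.
have [|||perm_are _] //= := class_tableaux (D := @permutation k) (s := [:: 0]) hla n_gt0.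
- move=> pi dpi [pm_pi parts]; split=> [B /pm_pi-> //|B Bpi].
  by have [/card_pair h /h[_ ->]] := parts B Bpi.
- move=> pi spec; suff pairs B : B \in pi -> #|top_part B| = 1 /\ #|bot_part B| = 1.
    by split=> // B /pairs[/card_pair h /h[]].
  by move/spec=> []; rewrite ?inE => // /eqP->.
have [|||pm_are planar_pm_are] //= :=
  class_tableaux (D := @perfect_matching k) (s := [:: 0; 2]) hla n_gt0.
- by move=> pi dpi pm_pi; split=> [B /pm_pi-> //|B /pm_pi->].
- move=> pi spec B /spec[t1 b1|]; first by have [] := card_pair B t1 b1.
  by rewrite !inE => /orP[/eqP->|/eqP].
have [|||pp_are planar_pp_are] //= :=
  class_tableaux (D := @partial_permutation k) (s := [:: 0; 1]) hla n_gt0.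
- move=> pi dpi pp_pi; split=> B /pp_pi[[->|B2] prop] //; first by rewrite B2.
  by rewrite prop.
- move=> pi spec B /spec[t1 b1|].
    by have [B2 prB] := card_pair B t1 b1; split; [right|].
  by rewrite !inE => /orP[/eqP->|/eqP->] // _; split; [left|].
have [|||m_are planar_m_are] //= :=
  class_tableaux (D := @matching k) (s := [:: 0; 1; 2]) hla n_gt0.
- move=> pi dpi m_pi; split=> // B /m_pi + _.
  by case: #|B| => [|[|[|]]].
- move=> pi spec B /spec[t1 b1|]; first by have [->] := card_pair B t1 b1.
  by rewrite !inE => /or3P[] /eqP->.
split; first by apply: insertion_tableaux_intro.
split; last by do 6 (split; first by []).
apply: insertion_tableaux_intro => // [pi dpi|S pi stdS planarS piS].
  exact: insertion_planar.
exact: mirror_planar stdS planarS piS.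
Qed.
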